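(* Let $b(n,m)$ denote the number of Arndt compositions of $n$ whose last part equals $m$, and let $\varphi=\frac{1+\sqrt5}{2}$. For every fixed positive integer $m$, as $n\to\infty$, $$b(n,m)\sim\frac{\varphi^{n-m-2}}{\sqrt 5}\left(1+ \frac{1}{\varphi^{m-1}}\right).$$
   Context: A composition of $n$ is a finite sequence $(\sigma_1,\dots,\sigma_\ell)$ of positive integers summing to $n$. An Arndt composition is one with $\sigma_{2i-1}>\sigma_{2i}$ for every positive integer $i$ with $2i\le\ell$. The last part of a nonempty composition is $\sigma_\ell$. *)

(* Defs.v *)
From HB Require Import structures.
From mathcomp Require Export all_boot all_order all_algebra.
From mathcomp Require Export finmap.
From mathcomp Require Export all_classical all_reals all_analysis.
Export Order.TTheory GRing.Theory Num.Theory.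
Export numFieldNormedType.Exports.

Set Implicit Arguments.
Unset Strict Implicit.
Unset Printing Implicit Defensive.

Local Open Scope classical_set_scope.

Definition is_composition (n : nat) (s : seq nat) : Prop :=
  (forall x, x \in s -> 0 < x) /\ sumn s = n.

(* sigma_j, with parts numbered from 1; only meaningful for 1 <= j <= size s *)
Definition part (s : seq nat) (j : nat) : nat := nth 0 s j.-1.

Definition is_arndt (s : seq nat) : Prop :=
  forall i, 0 < i -> 2 * i <= size s -> part s (2 * i) < part s (2 * i - 1).

Definition arndt_last (n m : nat) : set (seq nat) :=
  [set s | [/\ is_composition n s, is_arndt s, s <> [::] & part s (size s) = m]].

(* fset_set is fset0 on infinite sets; arndt_last_finite excludes that case *)
Definition b (n m : nat) : nat := #|` fset_set (arndt_last n m)|.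

Lemma bounded_seq_finite (n k : nat) :
  finite_set [set s : seq nat | size s <= k /\ forall x, x \in s -> x <= n].
Proof.
elim: k => [|k IH].
  apply: (@sub_finite_set _ _ [set [::]]); last exact: finite_set1.
  by move=> s [/=]; rewrite leqn0 => /nilP ->.
apply: (@sub_finite_set _ _ ([set [::]] `|`
  (fun p : nat * seq nat => p.1 :: p.2) @`
    (`I_n.+1 `*` [set s | size s <= k /\ forall x, x \in s -> x <= n]))).
  move=> [|x s] [/= sz le]; first by left.
  right; exists (x, s) => //; split => /=.
    by rewrite ltnS le ?mem_head.
  by split => // y ys; apply: le; rewrite inE ys orbT.
rewrite finite_setU; split; first exact: finite_set1.
by apply: finite_image; apply: finite_setX => //; exact: finite_II.
Qed.

Lemma arndt_last_finite (n m : nat) : finite_set (arndt_last n m).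
Proof.
apply: sub_finite_set (bounded_seq_finite n n) => s [[pos <-] _ _ _].
elim: s pos => [|x s IH] pos //=.
have [|sz le] := IH; first by move=> y ys; apply: pos; rewrite inE ys orbT.
have x0 : 0 < x by apply: pos; rewrite mem_head.
split; first by rewrite -add1n leq_add.
move=> y; rewrite inE => /predU1P[->|/le ys]; first exact: leq_addr.
exact: leq_trans ys (leq_addl _ _).
Qed.

Local Open Scope ring_scope.

Definition phi (R : realType) : R := (1 + Num.sqrt 5) / 2.

(* Main.v *)
(** Let [e n] count the even-length Arndt compositions of [n]. Splitting them
    by whether the first two parts differ by more than one (then lower the
    first part) or by exactly one (then lower both parts, or delete the pair
    [2, 1]) gives [e (n + 4) = e (n + 3) + e (n + 2)], hence
    [e (n + 2) = fib n]. Lowering the last part shows that the number [o n] of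
    odd-length ones satisfies [o (n + 1) = e n + o n], so
    [o (n + 2) = fib (n + 1)]. An Arndt composition of [n] with last part [m]
    is either an even-length one of [n - m] followed by [m], or ends in
    [a + m, m] and then corresponds to an odd-length one of [n - 2 m] ending
    in [a]. So [b n m = fib (n - m - 2) + fib (n - 2 m - 1)] for large [n], and
    Binet's formula concludes. *)

From mathcomp Require Import zify ring lra.
Require Import Defs.

Set Implicit Arguments.
Unset Strict Implicit.
Unset Printing Implicit Defensive.

Local Open Scope classical_set_scope.
Local Open Scope card_scope.
Local Open Scope nat_scope.

(** * Fibonacci numbers and counting tools *)

Fixpoint fib (n : nat) : nat :=
  match n with
  | 0 => 0
  | n'.+1 => if n' is n''.+1 then fib n' + fib n'' else 1
  end.

Lemma fibSS (n : nat) : fib n.+2 = fib n.+1 + fib n.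
Proof. by []. Qed.

(** Counts are stated as equipotence with [I_k], which carries finiteness along with the
    cardinal. *)
Lemma card_eq_disjointU (T : choiceType) (A B : set T) (p q : nat) :
  A #= `I_p -> B #= `I_q -> A `&` B = set0 -> A `|` B #= `I_(p + q).
Proof.
move=> Ap Bq AB0.
have finA : finite_set A by exists p.
have finB : finite_set B by exists q.
have finU : finite_set (A `|` B) by rewrite finite_setU.
suff <- : #|` fset_set (A `|` B)| = p + q.
  have [k Uk] := finU; suff -> : #|` fset_set (A `|` B)| = k by [].
  exact: card_fset_set.
rewrite fset_setU // cardfsU -fset_setI // AB0 fset_set0 cardfs0 subn0.
by rewrite (card_fset_set Ap) (card_fset_set Bq).
Qed.

Lemma card_eq_inj_image (T U : Type) (f : T -> U) (A : set T) (k : nat) :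
  injective f -> A #= `I_k -> f @` A #= `I_k.
Proof.
move=> finj Ak; apply: card_eq_trans Ak; apply: inj_card_eq.
by move=> x y _ _; exact: finj.
Qed.

Lemma list_pair_ind (T : Type) (P : seq T -> Prop) :
  P [::] -> (forall x, P [:: x]) ->
  (forall x y s, P s -> P [:: x, y & s]) -> forall s, P s.
Proof.
move=> P0 P1 P2 s; suff [] : P s /\ forall x, P (x :: s) by [].
by elim: s => [|y s [Ps Pys]]; split=> // x; exact: P2.
Qed.

(** * Arndt compositions *)

Lemma is_arndt_small (s : seq nat) : size s <= 1 -> is_arndt s.
Proof. by move=> s1 i i0 is'; exfalso; lia. Qed.

Lemma is_arndt_cons2 (x y : nat) (s : seq nat) :
  is_arndt [:: x, y & s] <-> y < x /\ is_arndt s.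
Proof.
rewrite /is_arndt /part; split=> [H|[yx H]].
  split; first exact: (H 1).
  move=> i i0 si; have := H i.+1 isT.
  rewrite [size _]/= (_ : (2 * i.+1).-1 = (2 * i).-1.+2); last by lia.
  rewrite (_ : (2 * i.+1 - 1).-1 = (2 * i - 1).-1.+2) /=; last by lia.
  by apply; lia.
case=> [//|[|i]] _; first by [].
rewrite [size _]/= => si.
have := H i.+1 isT.
rewrite (_ : (2 * i.+2).-1 = (2 * i.+1).-1.+2); last by lia.
rewrite (_ : (2 * i.+2 - 1).-1 = (2 * i.+1 - 1).-1.+2) /=; last by lia.
by apply; lia.
Qed.

(** With [s] of even length, no constrained pair straddles the junction. *)
Lemma is_arndt_cat (s t : seq nat) : ~~ odd (size s) ->
  is_arndt (s ++ t) <-> is_arndt s /\ is_arndt t.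
Proof.
elim/list_pair_ind: s => [_|//|x y s IH].
  by split=> [|[]] //; split=> //; exact: is_arndt_small.
by rewrite /= negbK => /IH {}IH; rewrite !is_arndt_cons2 IH; tauto.
Qed.

Lemma is_composition_nil (n : nat) : is_composition n [::] <-> n = 0.
Proof. by split=> [[_ <-]|->] //; split. Qed.

Lemma is_composition_cons (n x : nat) (s : seq nat) :
  is_composition n (x :: s) <-> [/\ 0 < x, x <= n & is_composition (n - x) s].
Proof.
split=> [[pos /= <-]|[x0 xn [pos sn]]].
  split; [by apply: pos; rewrite mem_head|exact: leq_addr|].
  split; last by lia.
  by move=> y ys; apply: pos; rewrite inE ys orbT.
split; last by rewrite /= sn; lia.
by move=> y; rewrite inE => /predU1P[->|/pos].
Qed.

Lemma is_composition_cat (n : nat) (s t : seq nat) :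
  is_composition n (s ++ t) <->
  [/\ is_composition (sumn s) s, sumn s <= n & is_composition (n - sumn s) t].
Proof.
split=> [[pos <-]|[[ps _] sn [pt tn]]].
  rewrite sumn_cat; split; [|exact: leq_addr|]; split => //; last by lia.
    by move=> x xs; apply: pos; rewrite mem_cat xs.
  by move=> x xt; apply: pos; rewrite mem_cat xt orbT.
split; last by rewrite sumn_cat tn; lia.
by move=> x; rewrite mem_cat => /orP[/ps|/pt].
Qed.

(** * Arndt compositions of even length *)

Definition even_arndt (n : nat) : set (seq nat) :=
  [set s | [/\ is_composition n s, is_arndt s & ~~ odd (size s)]].

(** The compositions whose first part cannot be lowered; counting them separately closes the
    recurrence. *)
Definition tight_arndt (n : nat) : set (seq nat) :=
  [set s | even_arndt n s /\ exists y t, s = [:: y.+1, y & t]].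

Lemma even_arndt_cons2 (n x y : nat) (s : seq nat) :
  even_arndt n [:: x, y & s] <->
  [/\ 0 < y, y < x, x + y <= n & even_arndt (n - (x + y)) s].
Proof.
split=> [[/is_composition_cons[x0 xn /is_composition_cons[y0 yn c]]]|].
  move=> /is_arndt_cons2[yx a]; rewrite /= negbK => e.
  by split=> //; [lia|split=> //; rewrite subnDA].
move=> [y0 yx xyn [c a e]]; split; last by rewrite /= negbK.
  apply/is_composition_cons; split; [lia|lia|].
  by apply/is_composition_cons; split=> //; [lia|rewrite -subnDA].
exact/is_arndt_cons2.
Qed.

Lemma even_arndt0 : even_arndt 0 = [set [::]].
Proof.
apply/seteqP; split=> [s|s ->].
  case: s => [//|x s] [/is_composition_cons[x0 xn _] _ _]; exfalso; lia.
by split=> //; exact: is_arndt_small.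
Qed.

Lemma even_arndt_small (n : nat) : 0 < n <= 2 -> even_arndt n = set0.
Proof.
move=> n2; apply/seteqP; split=> [s|s //].
case: s => [|x [|y s]] [].
- by move=> /is_composition_nil n0 _ _; exfalso; lia.
- by [].
- move=> c a o; have /even_arndt_cons2[] : even_arndt n [:: x, y & s] by [].
  by move=> *; exfalso; lia.
Qed.

Lemma tight_arndt_small (n : nat) : n <= 2 -> tight_arndt n = set0.
Proof.
move=> n2; apply/seteqP; split=> [s|s //] [+ [y [t st]]].
by rewrite st => /even_arndt_cons2[*]; exfalso; lia.
Qed.

Definition incr_head (s : seq nat) : seq nat :=
  if s is x :: t then x.+1 :: t else [::].

(** Shorter lists are left fixed, which keeps the map injective on all lists. *)
Definition incr_head2 (s : seq nat) : seq nat :=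
  if s is [:: x, y & t] then [:: x.+1, y.+1 & t] else s.

Lemma incr_head_inj : injective incr_head.
Proof. by move=> [|x s] [|y t] //= [-> ->]. Qed.

Lemma incr_head2_inj : injective incr_head2.
Proof. by move=> [|x [|x' s]] [|y [|y' t]] //= [-> -> ->]. Qed.

(** If the first two parts differ by at least two, lowering the first keeps the pair strictly
    decreasing; a difference of one is the tight case. *)
Lemma even_arndt_rec (n : nat) :
  even_arndt n.+2 = (incr_head @` even_arndt n.+1) `|` tight_arndt n.+2.
Proof.
apply/seteqP; split=> [s sE|s [[t tE <-]|[]//]].
- case: s sE => [[/is_composition_nil//]|x [[_ _ //]|y s]] sE.
  have := sE => /even_arndt_cons2 [y0 yx xyn sE'].
  have [xy|xy] := eqVneq x y.+1.
    by right; rewrite xy in sE *; split=> //; exists y, s.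
  left; exists [:: x.-1, y & s]; last by rewrite /= prednK //; lia.
  apply/even_arndt_cons2; split; try lia.
  by rewrite (_ : _ - _ = n.+2 - (x + y)) //; lia.
- case: t tE => [[/is_composition_nil//]|x [[_ _ //]|y t]].
  move=> /even_arndt_cons2 [y0 yx xyn sE'].
  by apply/even_arndt_cons2; split=> //; lia.
Qed.

(** A leading pair [y.+1, y] with [y] at least two is lowered in both parts; the pair [2, 1] would
    lose positivity and is deleted instead. *)
Lemma tight_arndt_rec (n : nat) : tight_arndt n.+3 =
  (incr_head2 @` tight_arndt n.+1) `|`
  ((fun s => [:: 2, 1 & s]) @` even_arndt n).
Proof.
apply/seteqP; split=> [s [sE [y [t st]]]|
  s [[u [uE [y [t ut]]] <-]|[t tE <-]]].
- move: sE; rewrite {}st => /even_arndt_cons2[y0 _ yn tE].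
  case: y => [//|[|y]] in y0 yn tE *.
    by right; exists t => //; rewrite (_ : n = n.+3 - (2 + 1)) //; lia.
  left; exists [:: y.+2, y.+1 & t] => //; split; last by exists y.+1, t.
  apply/even_arndt_cons2; split=> //; first by lia.
  by rewrite (_ : _ - _ = n.+3 - (y.+3 + y.+2)) //; lia.
- move: uE; rewrite {}ut => /even_arndt_cons2[y0 _ yn tE].
  split; last by exists y.+1, t.
  apply/even_arndt_cons2; split=> //; first by lia.
  by rewrite (_ : _ - _ = n.+1 - (y.+1 + y)) //; lia.
- split; last by exists 1, t.
  by apply/even_arndt_cons2; split=> //; rewrite (_ : _ - _ = n) //; lia.
Qed.

Lemma card_even_arndt_rec (n p q : nat) :
  even_arndt n.+1 #= `I_p -> tight_arndt n.+2 #= `I_q ->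
  even_arndt n.+2 #= `I_(p + q).
Proof.
move=> Ep Tq; rewrite even_arndt_rec; apply: card_eq_disjointU => //.
  by apply: card_eq_inj_image Ep; exact: incr_head_inj.
(* A tight list with its head lowered has equal first two parts, against the Arndt condition. *)
apply/seteqP; split=> // s [[u uE <-] [_ [y [t]]]].
case: u uE => [//|x u] uE /= [xy uy]; move: uE; rewrite {}xy {}uy.
by case=> _ /is_arndt_cons2[]; rewrite ltnn.
Qed.

Lemma card_tight_arndt_rec (n p q : nat) :
  tight_arndt n.+1 #= `I_p -> even_arndt n #= `I_q ->
  tight_arndt n.+3 #= `I_(p + q).
Proof.
move=> Tp Eq; rewrite tight_arndt_rec; apply: card_eq_disjointU.
- by apply: card_eq_inj_image Tp; exact: incr_head2_inj.
- by apply: card_eq_inj_image Eq => s t [].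
(* Raised lists have second part at least two, the others have second part one. *)
- apply/seteqP; split=> // s [[u [uE [y [t ut]]] <-] [v _]].
  by move: uE; rewrite ut => /even_arndt_cons2[y0 _ _ _] [_ y1]; lia.
Qed.

(** The even and tight recurrences feed each other, so one induction carries two consecutive counts
    of both families. *)
Lemma card_even_arndt (n : nat) : even_arndt n.+2 #= `I_(fib n).
Proof.
suff [] : [/\ even_arndt n.+2 #= `I_(fib n), even_arndt n.+3 #= `I_(fib n.+1),
    tight_arndt n.+4 #= `I_(fib n) & tight_arndt n.+3.+2 #= `I_(fib n.+1)]
  by [].
elim: n => [|n [E2 E3 T4 T5]].
  have E0 : even_arndt 0 #= `I_1 by rewrite even_arndt0; exact: card_set1.
  have E1 : even_arndt 1 #= `I_0 by rewrite even_arndt_small ?II0.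
  have E2 : even_arndt 2 #= `I_0 by rewrite even_arndt_small ?II0.
  have T1 : tight_arndt 1 #= `I_0 by rewrite tight_arndt_small ?II0.
  have T2 : tight_arndt 2 #= `I_0 by rewrite tight_arndt_small ?II0.
  have T3 := card_tight_arndt_rec T1 E0.
  split=> //; first exact: card_even_arndt_rec E2 T3.
    exact: card_tight_arndt_rec T2 E1.
  exact: card_tight_arndt_rec T3 E2.
split=> //; first exact: card_even_arndt_rec E3 T4.
by rewrite fibSS addnC; exact: card_tight_arndt_rec T4 E3.
Qed.

(** * Arndt compositions of odd length *)

(* [(s, a)] stands for the odd-length composition [rcons s a]. *)
Definition odd_arndt (n : nat) : set (seq nat * nat) :=
  [set p | [/\ 0 < p.2, p.2 <= n & even_arndt (n - p.2) p.1]].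

(** The last part of an odd-length composition lies in no constrained pair: it is lowered freely,
    and dropped once it is 1. *)
Lemma odd_arndt_rec (n : nat) : odd_arndt n.+1 =
  ((fun s => (s, 1)) @` even_arndt n) `|`
  ((fun p => (p.1, p.2.+1)) @` odd_arndt n).
Proof.
apply/seteqP; split=> [[s [|[|a]]] [//= _ an sE]|
  p [[s sE <-]|[[s a] [/= a0 an sE] <-]]].
- by left; exists s => //; rewrite subn1 in sE.
- by right; exists (s, a.+1).
- by split=> //=; rewrite subn1.
- by split.
Qed.

Lemma card_odd_arndt_rec (n p q : nat) :
  even_arndt n #= `I_p -> odd_arndt n #= `I_q -> odd_arndt n.+1 #= `I_(p + q).
Proof.
move=> Ep Oq; rewrite odd_arndt_rec; apply: card_eq_disjointU.
- by apply: card_eq_inj_image Ep => s t [].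
- by apply: card_eq_inj_image Oq => -[s a] [t c] [-> ->].
- by apply/seteqP; split=> // x [[s _ <-] [[t a] [/= a0 _ _] [_ a1]]]; lia.
Qed.

Lemma card_odd_arndt (n : nat) : odd_arndt n.+2 #= `I_(fib n.+1).
Proof.
elim: n => [|n IH].
  have E0 : even_arndt 0 #= `I_1 by rewrite even_arndt0; exact: card_set1.
  have E1 : even_arndt 1 #= `I_0 by rewrite even_arndt_small ?II0.
  have O0 : odd_arndt 0 #= `I_0.
    rewrite (_ : odd_arndt 0 = set0) ?II0 //.
    by apply/seteqP; split=> // -[s a] [/= *]; lia.
  exact: card_odd_arndt_rec E1 (card_odd_arndt_rec E0 O0).
by rewrite fibSS addnC; exact: card_odd_arndt_rec (card_even_arndt n) IH.
Qed.

(** * Prescribing the last part *)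

Lemma part_last (s : seq nat) : part s (size s) = last 0 s.
Proof. exact: nth_last. Qed.

(** After an even-length prefix the final [m] is unconstrained; after an odd-length one the part
    before it exceeds [m], and subtracting [m] from that part leaves an arbitrary positive one. *)
Lemma arndt_lastE (n m : nat) : 0 < m -> arndt_last (n + 2 * m) m =
  ((fun s => rcons s m) @` even_arndt (n + m)) `|`
  ((fun p => p.1 ++ [:: p.2 + m; m]) @` odd_arndt n).
Proof.
move=> m0; apply/seteqP; split=> [s|s].
  case/lastP: s => [[_ _ //]|s x] [c a _]; rewrite part_last last_rcons => xm.
  rewrite {}xm in c a *.
  have [os|es] := boolP (odd (size s)); last first.
    left; exists s => //; split=> //.
    + move: c; rewrite -cats1 => /is_composition_cat[[ps _] sn].
      move=> /is_composition_cons[_ mn /is_composition_nil e].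
      by split=> //; lia.
    + by move: a; rewrite -cats1 => /is_arndt_cat => /(_ es)[].
  case/lastP: s => [//|s y] in os c a *; right.
  rewrite size_rcons /= in os.
  rewrite -!cats1 -catA /= in c a *.
  have [aS /is_arndt_cons2[my _]] := (is_arndt_cat _ os).1 a.
  move: c => /is_composition_cat[[ps _] sn /is_composition_cons[_ yn]].
  move=> /is_composition_cons[_ mn /is_composition_nil e].
  exists (s, y - m); last by rewrite /= subnK // ltnW.
  by split=> /=; [lia|lia|split=> //; split=> //; lia].
case=> [[t [[pt st] at_ et] <-]|[[t a] [/= a0 an [[pt st] at_ et]] <-]].
- split; rewrite ?part_last ?last_rcons //; last by case: t {pt st at_ et}.
    rewrite -cats1; apply/is_composition_cat; split=> //; first by lia.
    apply/is_composition_cons; split=> //; first by lia.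
    by apply/is_composition_nil; lia.
  by rewrite -cats1; apply/is_arndt_cat => //; split=> //; exact: is_arndt_small.
- split; rewrite ?part_last ?last_cat //; last by case: t {pt st at_ et}.
    apply/is_composition_cat; split=> //; first by lia.
    apply/is_composition_cons; split=> //; [lia|lia|].
    apply/is_composition_cons; split=> //; first by lia.
    by apply/is_composition_nil; lia.
  apply/is_arndt_cat => //; split=> //; apply/is_arndt_cons2.
  by split; [lia|exact: is_arndt_small].
Qed.

Lemma b_fib (n m : nat) : 0 < m ->
  b (n.+2 + 2 * m) m = fib (n + m) + fib n.+1.
Proof.
move=> m0; apply: card_fset_set; rewrite arndt_lastE //.
apply: card_eq_disjointU.
- by apply: card_eq_inj_image (card_even_arndt _); exact: rcons_injl.
- apply: card_eq_inj_image (card_odd_arndt _) => -[s x] [t y] /=.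
  rewrite -!cat_rcons !cats0 => /(@rcons_injl _ m) /rcons_inj[-> xy].
  by congr (_, _); lia.
(* Lists in the first image have odd length, those in the second even length. *)
- apply/seteqP; split=> // u [[s [_ _ es] <-] [[t a] [/= _ _ [_ _ et]]]].
  move=> /(congr1 (odd \o size)); rewrite /= size_rcons size_cat /= oddD.
  by case: odd et es => //; case: odd.
Qed.

Local Open Scope ring_scope.

(** * Binet's formula *)

(** The conjugate of [phi]: the other root of x^2 = x + 1. *)
Definition psi (R : realType) : R := (1 - Num.sqrt 5) / 2.

Lemma sqr_sqrt5 (R : realType) : Num.sqrt (5 : R) ^+ 2 = 5.
Proof. by rewrite sqr_sqrtr. Qed.

Lemma sqrt5_gt2 (R : realType) : 2 < Num.sqrt (5 : R).
Proof.
rewrite -(@ltr_pXn2r _ 2) ?nnegrE ?sqrtr_ge0 // sqr_sqrt5; lra.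
Qed.

Lemma sqrt5_lt3 (R : realType) : Num.sqrt (5 : R) < 3.
Proof.
rewrite -(@ltr_pXn2r _ 2) ?nnegrE ?sqrtr_ge0 // sqr_sqrt5; lra.
Qed.

Lemma phi_gt1 (R : realType) : 1 < phi R.
Proof. by rewrite /phi; have := sqrt5_gt2 R; lra. Qed.

Lemma norm_psi_le1 (R : realType) : `|psi R| <= 1.
Proof.
by rewrite ler_norml /psi; have := sqrt5_gt2 R; have := sqrt5_lt3 R; lra.
Qed.

Lemma phi_sqr (R : realType) : phi R ^+ 2 = phi R + 1.
Proof.
by have := sqr_sqrt5 R; rewrite /phi; move: (Num.sqrt 5) => r r5; lra.
Qed.

Lemma psi_sqr (R : realType) : psi R ^+ 2 = psi R + 1.
Proof.
by have := sqr_sqrt5 R; rewrite /psi; move: (Num.sqrt 5) => r r5; lra.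
Qed.

Lemma binet (R : realType) (n : nat) :
  (fib n)%:R * Num.sqrt 5 = phi R ^+ n - psi R ^+ n.
Proof.
suff [] : (fib n)%:R * Num.sqrt 5 = phi R ^+ n - psi R ^+ n /\
  (fib n.+1)%:R * Num.sqrt 5 = phi R ^+ n.+1 - psi R ^+ n.+1 by [].
elim: n => [|n [IH IHS]].
  by rewrite !expr0 !expr1 /phi /psi /=; split; field.
split=> //; rewrite fibSS natrD mulrDl IH IHS.
by rewrite -[n.+2]addn2 !exprD phi_sqr psi_sqr !exprS; ring.
Qed.

(** * The asymptotic equivalence *)

(* [^] is the power with an integer exponent, as n - m - 2 may be negative. *)
Theorem theorem3p4 (R : realType) (m : nat) (hm : (0 < m)%N) :
  (fun n : nat => (b n m)%:R : R) ~_\oo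
  (fun n : nat => phi R ^ (n%:Z - m%:Z - 2) / Num.sqrt 5
                  * (1 + 1 / phi R ^+ (m - 1))).
Proof.
apply/eqaddoP => eps eps0.
have phi1 := phi_gt1 R; have phi0 : 0 < phi R by apply: lt_trans phi1.
have r0 : 0 < Num.sqrt (5 : R) by apply: lt_trans (sqrt5_gt2 R).
have phiV1 : `|(phi R)^-1| < 1 by rewrite ger0_norm ?invr_ge0 ?ltW // invf_lt1.
have e20 : 0 < eps / 2 by rewrite divr_gt0.
have [N _ HN] := cvgr0_norm_lt _ (cvg_expr phiV1) _ e20.
(* Past this threshold [n] has the form required by [b_fib], with [k] at least [N]. *)
exists (N.+2 + 2 * m)%N => // n /= Nn.
have [k -> Nk] : exists2 k, n = (k.+2 + 2 * m)%N & (N <= k)%N.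
  by exists (n - 2 * m - 2)%N; lia.
(* The constant 2 bounds the sum of the two powers of [psi] in the error, each of norm at most 1. *)
have {HN}phik : 2 <= eps * phi R ^+ k.+1.
  have := HN k Nk; rewrite /= normrX gtr0_norm ?invr_gt0 // exprVn.
  rewrite invf_plt ?posrE ?exprn_gt0 // invf_div => lek.
  rewrite mulrC -ler_pdivrMr //; apply: le_trans (ltW lek) _.
  by rewrite exprS ler_peMl ?exprn_ge0 // ltW.
(* The integer exponent equals [k + m], and dividing by [phi R ^+ (m - 1)] brings it down to
   [k.+1]. *)
have gE : phi R ^ ((k.+2 + 2 * m)%N%:Z - m%:Z - 2) / Num.sqrt 5 *
    (1 + 1 / phi R ^+ (m - 1)) =
    (phi R ^+ (k + m) + phi R ^+ k.+1) / Num.sqrt 5.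
  rewrite (_ : _ - _ - _ = (k + m)%N%:Z); last by lia.
  rewrite -exprnP (_ : (k + m = k.+1 + (m - 1))%N); last by lia.
  rewrite exprD; field.
  by rewrite expf_neq0 gt_eqF.
have fE : (b (k.+2 + 2 * m) m)%:R = (phi R ^+ (k + m) + phi R ^+ k.+1
     - (psi R ^+ (k + m) + psi R ^+ k.+1)) / Num.sqrt 5.
  apply: (canRL (mulfK _)); first by rewrite gt_eqF.
  by rewrite b_fib // natrD mulrDl !binet; ring.
(* The powers of [phi] cancel in the difference, leaving those of [psi]; the common factor 1 / sqrt
   5 is then dropped. *)
rewrite /= !fctE gE fE -mulrBl addrAC subrr add0r.
rewrite !normrM normrN mulrA ler_wpM2r //.
have psi_le j : `|psi R ^+ j| <= 1 by rewrite normrX exprn_ile1 ?norm_psi_le1.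
apply: le_trans (_ : 2 <= _).
  apply: le_trans (ler_normD _ _) _.
  by have := psi_le (k + m)%N; have := psi_le k.+1; lra.
apply: le_trans phik _; rewrite ler_pM2l // gtr0_norm ?addr_gt0 ?exprn_gt0 //.
by rewrite lerDr exprn_ge0 // ltW.
Qed.
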